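(* Let $(\mathfrak g_0^1,B_0^1,(\rho_1,V_1))$ and $(\mathfrak g_0^2,B_0^2,(\rho_2,V_2))$ be fundamental triplets over $\mathbb C$. Let $\widetilde\gamma:V_1^*\to V_2^*$ and $\gamma:V_1\to V_2$ be isomorphisms of vector spaces and let $A:\mathfrak g_0^1\to\mathfrak g_0^2$ be an isomorphism of Lie algebras. Then the graded linear map $$\Psi=(\widetilde\gamma,A,\gamma):\Gamma(\mathfrak g_0^1,B_0^1,\rho_1)=V_1^*\oplus\mathfrak g_0^1\oplus V_1\longrightarrow\Gamma(\mathfrak g_0^2,B_0^2,\rho_2)=V_2^*\oplus\mathfrak g_0^2\oplus V_2$$ (equal to $\widetilde\gamma$, $A$, $\gamma$ on $V_1^*$, $\mathfrak g_0^1$, $V_1$ respectively) is an isomorphism of local Lie algebras if and only if the following three conditions hold for all $U_1\in\mathfrak g_0^1$, $X_1\in V_1$, $Y_1\in V_1^*$: 1) $\rho_2(A(U_1))\circ\gamma=\gamma\circ\rho_1(U_1)$; 2) $\rho_2^*(A(U_1))\circ\widetilde\gamma=\widetilde\gamma\circ\rho_1^*(U_1)$; 3) $B_0^2(A([X_1,Y_1]),A(U_1))=B_0^1([\,{}^t\widetilde\gamma\circ\gamma(X_1),Y_1],U_1)$, where the brackets in 3) are those of $\Gamma(\mathfrak g_0^1,B_0^1,\rho_1)$ and ${}^t\widetilde\gamma:V_2\to V_1$ is the transpose of $\widetilde\gamma$.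
   Context: All vector spaces and Lie algebras are over $\mathbb C$. A quadratic Lie algebra is a pair $(\mathfrak g_0,B_0)$ where $\mathfrak g_0$ is a finite-dimensional Lie algebra and $B_0$ is a non-degenerate invariant symmetric bilinear form on $\mathfrak g_0$. A fundamental triplet $(\mathfrak g_0,B_0,(\rho,V))$ consists of a quadratic Lie algebra $(\mathfrak g_0,B_0)$ and a finite-dimensional representation $(\rho,V)$ of $\mathfrak g_0$; $(\rho^*,V^* )$ is the contragredient representation. A local Lie algebra is a direct sum $\Gamma=\mathfrak g_{-1}\oplus\mathfrak g_0\oplus\mathfrak g_1$ of finite-dimensional spaces with bilinear anticommutative brackets $\mathfrak g_i\times\mathfrak g_j\to\mathfrak g_{i+j}$ for $i,j\in\{-1,0,1\}$ with $|i+j|\le1$, such that the Jacobi identity holds each time its three terms are defined. Morphisms of local Lie algebras are degree-preserving linear maps compatible with all defined brackets. To a fundamental triplet one associates the local Lie algebra $\Gamma(\mathfrak g_0,B_0,\rho)=V^*\oplus\mathfrak g_0\oplus V$ (degrees $-1,0,1$) with the bracket of $\mathfrak g_0$, $[U,X]=\rho(U)X$, $[U,Y]=\rho^*(U)Y$, and $[X,Y]\in\mathfrak g_0$ defined by $B_0([X,Y],U)=Y(\rho(U)X)$ for all $U\in\mathfrak g_0$ ($X\in V$, $Y\in V^*$). *)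

(* Defs.v *)
From HB Require Import structures.
From mathcomp Require Import all_boot all_order all_algebra.
From mathcomp Require Import reals complex.

Set Implicit Arguments.
Unset Strict Implicit.
Unset Printing Implicit Defensive.

Import GRing.Theory.
Local Open Scope ring_scope.

HB.mixin Record hasLieBracket (K : fieldType) L of Vector K L := {
  lie : L -> L -> L;
  lie_bilinear : bilinear_for *:%R *:%R lie;
  liexx : forall x, lie x x = 0;
  lie_jacobi : forall x y z,
    lie x (lie y z) + lie y (lie z x) + lie z (lie x y) = 0
}.

#[short(type="lieAlgType")]
HB.structure Definition LieAlgebra (K : fieldType) :=
  {L of hasLieBracket K L & Vector K L}.

HB.instance Definition _ (K : fieldType) (g : lieAlgType K) :=
  bilinear_isBilinear.Build K g g g *:%R *:%R (@lie K g) (@lie_bilinear K g).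

Lemma lieC (K : fieldType) (g : lieAlgType K) (x y : g) : lie x y = - lie y x.
Proof.
have := liexx (x + y).
rewrite linearDl !linearDr /= !liexx add0r addr0 => /eqP.
by rewrite addr_eq0 => /eqP.
Qed.

Definition is_lie_isomorphism (K : fieldType) (g h : lieAlgType K)
    (A : 'Hom(g, h)) : Prop :=
  bijective A /\ (forall x y : g, A (lie x y) = lie (A x) (A y)).

(* The non-degenerate invariant symmetric form of a quadratic Lie algebra. *)
Record quadForm (K : fieldType) (g : lieAlgType K) := QuadForm {
  qform :> g -> g -> K;
  qform_bilinear : bilinear_for *%R *%R qform;
  qformC : forall x y, qform x y = qform y x;
  qform_invariant : forall x y z, qform (lie x y) z = qform x (lie y z);
  qform_nondegenerate : forall x, (forall y, qform x y = 0) -> x = 0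
}.

Record lieRep (K : fieldType) (g : lieAlgType K) (V : vectType K) := LieRep {
  rep :> 'Hom(g, 'End(V));
  rep_lie : forall x y : g,
    rep (lie x y) = ((rep x \o rep y) - (rep y \o rep x))%VF
}.

Section LinearMaps.
Variable K : fieldType.
Implicit Types V W : vectType K.

Lemma lfun_invK V W (f : 'Hom(V, W)) :
  injective f -> dim V = dim W -> cancel (f^-1)%VF f.
Proof.
move=> finj dVW w; apply: limg_lfunVK.
suff -> : limg f = fullv by apply: memvf.
apply/eqP; rewrite eqEdim subvf /= dimvf -dVW -dimvf limg_dim_eq //.
by move/lker0P: finj => /eqP ->; rewrite capv0.
Qed.

Definition eval_fun V W (x : V) (f : 'Hom(V, W)) : W := f x.

Lemma eval_is_linear V W (x : V) : linear (@eval_fun V W x).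
Proof. by move=> a f g; rewrite /eval_fun !lfunE /= lfunE. Qed.

HB.instance Definition _ V W (x : V) :=
  GRing.isLinear.Build K 'Hom(V, W) W _ (@eval_fun V W x)
    (@eval_is_linear V W x).

Definition eval_at V W (x : V) : 'Hom('Hom(V, W), W) := linfun (@eval_fun V W x).

Lemma eval_atE V W (x : V) (f : 'Hom(V, W)) : eval_at W x f = f x.
Proof. by rewrite lfunE. Qed.

Lemma eval_at_is_linear V W : linear (@eval_at V W).
Proof.
move=> a x y; apply/lfunP => f.
by rewrite add_lfunE scale_lfunE !eval_atE linearP.
Qed.

HB.instance Definition _ V W :=
  GRing.isLinear.Build K V 'Hom('Hom(V, W), W) _ (@eval_at V W)
    (@eval_at_is_linear V W).

Definition dual V : vectType K := 'Hom(V, K^o).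

Lemma dim_dual V : dim (dual V) = dim V.
Proof. by rewrite /dim /= muln1. Qed.

Definition dual_map_fun V W (f : 'Hom(V, W)) (Y : dual W) : dual V := (Y \o f)%VF.

Lemma dual_map_fun_is_linear V W (f : 'Hom(V, W)) : linear (dual_map_fun f).
Proof. by move=> a Y Z; rewrite /dual_map_fun comp_lfunDl comp_lfunZl. Qed.

HB.instance Definition _ V W (f : 'Hom(V, W)) :=
  GRing.isLinear.Build K (dual W) (dual V) _ (dual_map_fun f)
    (dual_map_fun_is_linear f).

Definition dual_map V W (f : 'Hom(V, W)) : 'Hom(dual W, dual V) :=
  linfun (dual_map_fun f).

Lemma dual_mapE V W (f : 'Hom(V, W)) (Y : 'Hom(W, K^o)) (x : V) :
  (dual_map f Y : 'Hom(V, K^o)) x = Y (f x).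
Proof. by rewrite lfunE /= /dual_map_fun comp_lfunE. Qed.

Lemma dual_map_is_linear V W : linear (@dual_map V W).
Proof.
move=> a f g; apply/lfunP => Y; apply/lfunP => x.
by rewrite dual_mapE !add_lfunE !scale_lfunE linearP /= !dual_mapE.
Qed.

HB.instance Definition _ V W :=
  GRing.isLinear.Build K 'Hom(V, W) 'Hom(dual W, dual V) _ (@dual_map V W)
    (@dual_map_is_linear V W).

Definition bidual V : 'Hom(V, dual (dual V)) := linfun (@eval_at V K^o).

Lemma bidualE V (x : V) (Y : 'Hom(V, K^o)) :
  (bidual V x : 'Hom(dual V, K^o)) Y = Y x.
Proof. by rewrite [bidual V x]lfunE eval_atE. Qed.

Lemma dual_separates V (x : V) : (forall Y : 'Hom(V, K^o), Y x = 0) -> x = 0.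
Proof.
move=> x0; rewrite (coord_vbasis (memvf x)) big1 // => i _.
pose c : {linear V -> K^o} := HB.pack_for {linear V -> K^o}
  (coord (vbasis (@fullv K V)) i : V -> K^o)
  (GRing.isLinear.Build K V K^o _ (coord (vbasis (@fullv K V)) i : V -> K^o)
    (fun a u v => linearP (coord (vbasis (@fullv K V)) i) a u v)).
by have := x0 (linfun c); rewrite lfunE /= => ->; rewrite scale0r.
Qed.

Lemma bidualK V : cancel (bidual V)^-1%VF (bidual V).
Proof.
apply: lfun_invK; last by rewrite !dim_dual.
move=> x y xy; apply/eqP; rewrite -subr_eq0; apply/eqP.
by apply: dual_separates => Y; rewrite -bidualE linearB /= xy subrr lfunE.
Qed.

(* The transpose of [f : V^* -> W^*], read as a map [W -> V] through the      *)
(* canonical isomorphisms of [V] and [W] with their biduals.                  *)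
Definition transpose V W (f : 'Hom(dual V, dual W)) : 'Hom(W, V) :=
  ((bidual V)^-1 \o dual_map f \o bidual W)%VF.

Lemma transposeE V W (f : 'Hom(dual V, dual W)) (Y : 'Hom(V, K^o)) (x : W) :
  Y (transpose f x) = (f Y : 'Hom(W, K^o)) x.
Proof. by rewrite -bidualE !comp_lfunE bidualK dual_mapE bidualE. Qed.

End LinearMaps.

Lemma rep_lieE (K : fieldType) (g : lieAlgType K) (V : vectType K)
    (rho : lieRep g V) (x y : g) (v : V) :
  rho (lie x y) v = rho x (rho y v) - rho y (rho x v).
Proof. by rewrite rep_lie !(add_lfunE, opp_lfunE, comp_lfunE). Qed.

Section Contragredient.
Variables (K : fieldType) (g : lieAlgType K) (V : vectType K) (rho : lieRep g V).

Definition dual_rep_fun (U : g) : 'End(dual V) := - dual_map (rho U).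

Lemma dual_rep_fun_is_linear : linear dual_rep_fun.
Proof.
by move=> a U W; rewrite /dual_rep_fun !linearP.
Qed.

HB.instance Definition _ :=
  GRing.isLinear.Build K g 'End(dual V) _ dual_rep_fun dual_rep_fun_is_linear.

Lemma dual_rep_funE (U : g) (Y : 'Hom(V, K^o)) (X : V) :
  (linfun dual_rep_fun U Y : 'Hom(V, K^o)) X = - Y (rho U X).
Proof. by rewrite [linfun _ U]lfunE /= !opp_lfunE dual_mapE. Qed.

Lemma dual_rep_lie (x y : g) :
  linfun dual_rep_fun (lie x y) =
  ((linfun dual_rep_fun x \o linfun dual_rep_fun y) -
   (linfun dual_rep_fun y \o linfun dual_rep_fun x))%VF.
Proof.
apply/lfunP => Y; apply/lfunP => X.
rewrite dual_rep_funE rep_lieE !(add_lfunE, opp_lfunE, comp_lfunE).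
by rewrite !dual_rep_funE linearB /= !opprK opprB.
Qed.

Definition contragredient : lieRep g (dual V) :=
  LieRep dual_rep_lie.

Lemma contragredientE (U : g) (Y : 'Hom(V, K^o)) (X : V) :
  (contragredient U Y : 'Hom(V, K^o)) X = - Y (rho U X).
Proof. exact: dual_rep_funE. Qed.

End Contragredient.

Section Pairing.
Variables (K : fieldType) (g : lieAlgType K) (B : quadForm g).
Variables (V : vectType K) (rho : lieRep g V).

Definition qform_left (U : g) : g -> K^o := B U.

Lemma qform_left_is_linear (U : g) : linear (qform_left U).
Proof. exact: (qform_bilinear B).2 U. Qed.

HB.instance Definition _ (U : g) :=
  GRing.isLinear.Build K g K^o _ (qform_left U) (qform_left_is_linear U).

Definition qform_dual_fun (U : g) : dual g := linfun (qform_left U).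

Lemma qform_dual_fun_is_linear : linear qform_dual_fun.
Proof.
move=> a U W; apply/lfunP => Z.
rewrite add_lfunE scale_lfunE !lfunE.
exact: (qform_bilinear B).1 Z a U W.
Qed.

HB.instance Definition _ :=
  GRing.isLinear.Build K g (dual g) _ qform_dual_fun qform_dual_fun_is_linear.

Definition qform_dual : 'Hom(g, dual g) := linfun qform_dual_fun.

Lemma qform_dualE (U W : g) : (qform_dual U : 'Hom(g, K^o)) W = B U W.
Proof. by rewrite [qform_dual U]lfunE lfunE. Qed.

Lemma qform_dualK : cancel qform_dual^-1%VF qform_dual.
Proof.
apply: lfun_invK; last by rewrite dim_dual.
move=> x y xy; apply/eqP; rewrite -subr_eq0; apply/eqP.
apply: (@qform_nondegenerate _ _ B) => z.
by rewrite -qform_dualE linearB /= xy subrr lfunE.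
Qed.

Lemma qform_inj (U W : g) : (forall Z, B U Z = B W Z) -> U = W.
Proof.
move=> UW; apply/eqP; rewrite -subr_eq0; apply/eqP.
apply: (@qform_nondegenerate _ _ B) => z.
by rewrite -qform_dualE linearB /= add_lfunE opp_lfunE !qform_dualE UW subrr.
Qed.

(* The element [X, Y] of g with [B [X, Y] U = Y (rho U X)]: see               *)
(* [qform_pairing].                                                           *)
Definition pairing (X : V) (Y : dual V) : g :=
  (qform_dual^-1)%VF ((Y : 'Hom(V, K^o)) \o eval_at V X \o rho)%VF.

Lemma qform_pairing (X : V) (Y : 'Hom(V, K^o)) (U : g) :
  B (pairing X Y) U = Y (rho U X).
Proof. by rewrite -qform_dualE qform_dualK !comp_lfunE eval_atE. Qed.

End Pairing.

Inductive degree := degN1 | deg0 | deg1.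

Definition degree_int (i : degree) : int :=
  match i with degN1 => -1 | deg0 => 0 | deg1 => 1 end.

Definition adds (i j k : degree) : Prop :=
  degree_int i + degree_int j = degree_int k.

(* A bracket [G i * G j -> G k] is given exactly when [adds i j k]: there is  *)
(* none when [i] and [j] are both 1 or both -1.                               *)
Record localLieAlg (K : fieldType) := LocalLieAlg {
  lcomp :> degree -> vectType K;
  lbr : forall i j k : degree,
    adds i j k -> lcomp i -> lcomp j -> lcomp k;
  lbr_bilinear : forall (i j k : degree) (e : adds i j k),
    bilinear_for *:%R *:%R (lbr e);
  lbr_anticomm : forall (i j k : degree)
      (e : adds i j k) (e' : adds j i k)
      (x : lcomp i) (y : lcomp j),
    lbr e x y = - lbr e' y x;
  lbr_jacobi : forall (i j k ij jk ki l : degree)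
      (eij : adds i j ij) (ejk : adds j k jk)
      (eki : adds k i ki)
      (ei : adds i jk l) (ej : adds j ki l) (ek : adds k ij l)
      (x : lcomp i) (y : lcomp j) (z : lcomp k),
    lbr ei x (lbr ejk y z) + lbr ej y (lbr eki z x) + lbr ek z (lbr eij x y) = 0
}.

Section LocalMorphisms.
Variable K : fieldType.
Implicit Types G H : localLieAlg K.

Definition gradedHom G H := forall i : degree, 'Hom(G i, H i).

Definition is_local_morphism G H (Psi : gradedHom G H) : Prop :=
  forall (i j k : degree) (e : adds i j k) (x : G i) (y : G j),
    Psi k (lbr e x y) = lbr e (Psi i x) (Psi j y).

Definition is_local_isomorphism G H (Psi : gradedHom G H) : Prop :=
  is_local_morphism Psi /\
  exists Phi : gradedHom H G,
    is_local_morphism Phi /\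
    (forall i, cancel (Psi i) (Phi i) /\ cancel (Phi i) (Psi i)).

End LocalMorphisms.

Section LocalOfTriplet.
Variables (K : fieldType) (g : lieAlgType K) (B : quadForm g).
Variables (V : vectType K) (rho : lieRep g V).

Definition triplet_comp (i : degree) : vectType K :=
  match i with degN1 => dual V | deg0 => g | deg1 => V end.

(* The value of the catch-all clause is irrelevant: it is never reached when  *)
(* [adds i j k].                                                               *)
Definition triplet_br (i j k : degree) :
    triplet_comp i -> triplet_comp j -> triplet_comp k :=
  match i, j, k
  return triplet_comp i -> triplet_comp j -> triplet_comp k with
  | deg0, deg0, deg0 => fun U U' => lie U U'
  | deg0, deg1, deg1 => fun U X => rho U X
  | deg1, deg0, deg1 => fun X U => - rho U X
  | deg0, degN1, degN1 => fun U Y => contragredient rho U Y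
  | degN1, deg0, degN1 => fun Y U => - contragredient rho U Y
  | deg1, degN1, deg0 => fun X Y => pairing B rho X Y
  | degN1, deg1, deg0 => fun Y X => - pairing B rho X Y
  | _, _, _ => fun _ _ => 0
  end.

Lemma pairing_linearl (Y : dual V) : linear (fun X => pairing B rho X Y).
Proof.
move=> a X X'; apply: (qform_inj (B := B)) => U.
have := (qform_bilinear B).1 U a => /= ->.
by rewrite !qform_pairing !linearP.
Qed.

Lemma pairing_linearr (X : V) : linear (pairing B rho X).
Proof.
move=> a Y Y'; apply: (qform_inj (B := B)) => U.
have := (qform_bilinear B).1 U a => /= ->.
by rewrite !qform_pairing add_lfunE scale_lfunE.
Qed.

Lemma qformD (x y z : g) : B (x + y) z = B x z + B y z.
Proof. by rewrite -!qform_dualE linearD add_lfunE. Qed.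

Lemma qformN (x z : g) : B (- x) z = - B x z.
Proof. by rewrite -!qform_dualE linearN opp_lfunE. Qed.

HB.instance Definition _ (X : V) :=
  GRing.isLinear.Build K (dual V) g _ (pairing B rho X) (pairing_linearr X).

Lemma pairingNl (X : V) (Y : dual V) : pairing B rho (- X) Y = - pairing B rho X Y.
Proof.
by apply: (qform_inj (B := B)) => U; rewrite qformN !qform_pairing !linearN.
Qed.

Lemma lie_pairing (U : g) (X : V) (Y : dual V) :
  lie U (pairing B rho X Y) =
  pairing B rho (rho U X) Y + pairing B rho X (contragredient rho U Y).
Proof.
apply: (qform_inj (B := B)) => W.
rewrite qformD !qform_pairing contragredientE lieC qformN qform_invariant.
by rewrite qform_pairing rep_lieE linearB /= opprB.
Qed.

Lemma triplet_br_bilinear (i j k : degree) :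
  adds i j k -> bilinear_for *:%R *:%R (@triplet_br i j k).
Proof.
have rl (W : vectType K) (r : lieRep g W) (w : W) : linear (fun U => r U w).
  by move=> a U U'; rewrite linearP add_lfunE scale_lfunE.
have rr (W : vectType K) (r : lieRep g W) (U : g) : linear (r U).
  by move=> a w w'; rewrite linearP.
have op (W W' : vectType K) (f : W -> W') : linear f -> linear (fun w => - f w).
  by move=> lf a u v; rewrite lf opprD scalerN.
have ll := (@lie_bilinear K g).1; have lr := (@lie_bilinear K g).2.
case: i j k => [] [] [] // _; split=> u;
  solve [exact: (rr _ (contragredient rho)) | exact: (rl _ (contragredient rho))
     | exact: (op _ _ _ (rr _ (contragredient rho) u))
     | exact: (op _ _ _ (rl _ (contragredient rho) u)) | exact: rr | exact: rl | exact/op/rr | exact/op/rl | exact: ll | exact: lr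
     | exact: pairing_linearl | exact: pairing_linearr
     | exact/op/pairing_linearl | exact/op/pairing_linearr].
Qed.

Lemma triplet_br_anticomm (i j k : degree) (x : triplet_comp i)
    (y : triplet_comp j) :
  adds i j k -> @triplet_br i j k x y = - @triplet_br j i k y x.
Proof.
case: i x; case: j y; case: k => //= y x _; rewrite ?opprK //; exact: lieC.
Qed.

Lemma triplet_br_jacobi (i j k ij jk ki l : degree)
    (eij : adds i j ij) (ejk : adds j k jk) (eki : adds k i ki)
    (ei : adds i jk l) (ej : adds j ki l) (ek : adds k ij l)
    (x : triplet_comp i) (y : triplet_comp j) (z : triplet_comp k) :
  @triplet_br i jk l x (triplet_br jk y z) +
  @triplet_br j ki l y (triplet_br ki z x) +
  @triplet_br k ij l z (triplet_br ij x y) = 0.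
Proof.
have sum12 (W : zmodType) (p q r s : W) :
    p + q = 0 -> r + s = 0 -> p + q + r + s = 0.
  by move=> -> ?; rewrite add0r.
have sum13 (W : zmodType) (p q r s : W) :
    p + r = 0 -> q + s = 0 -> p + q + r + s = 0.
  by move=> pr qs; rewrite -addrA addrACA pr qs addr0.
have sum14 (W : zmodType) (p q r s : W) :
    p + s = 0 -> q + r = 0 -> p + q + r + s = 0.
  by move=> ps qr; rewrite -(addrA p) qr addr0.
have lieNr (U W : g) : lie U (- W) = - lie U W by rewrite linearNr.
move: x y z.
destruct i, j; destruct ij; try discriminate eij;
destruct k; destruct jk; try discriminate ejk;
destruct ki; try discriminate eki;
destruct l; try discriminate ei; try discriminate ej; try discriminate ek;
move=> x y z; rewrite /triplet_br; first [exact: lie_jacobi | idtac];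
rewrite ?(rep_lieE, lie_pairing, lieNr, pairingNl, linearN, opprD, opprK)
  ?(opprB, opprD, opprK, addrA).
all: by [apply: sum12; rewrite ?subrr ?addNr
        | apply: sum13; rewrite ?subrr ?addNr
        | apply: sum14; rewrite ?subrr ?addNr].
Qed.

Definition localLie_of_triplet : localLieAlg K :=
  LocalLieAlg triplet_br_bilinear
    (fun i j k e _ x y => triplet_br_anticomm x y e) triplet_br_jacobi.

End LocalOfTriplet.

Section GradedTriplet.
Variables (K : fieldType) (g1 g2 : lieAlgType K).
Variables (B1 : quadForm g1) (B2 : quadForm g2) (V1 V2 : vectType K).
Variables (rho1 : lieRep g1 V1) (rho2 : lieRep g2 V2).

Definition graded_triplet (gammat : 'Hom(dual V1, dual V2)) (A : 'Hom(g1, g2))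
    (gamma : 'Hom(V1, V2)) :
  gradedHom (localLie_of_triplet B1 rho1) (localLie_of_triplet B2 rho2) :=
  fun i => match i return 'Hom(triplet_comp g1 V1 i, triplet_comp g2 V2 i) with
           | degN1 => gammat | deg0 => A | deg1 => gamma
           end.

End GradedTriplet.

Definition adds_1N1 : adds deg1 degN1 deg0 := erefl.

(* Main.v *)
Require Import Defs.
From mathcomp Require Import all_boot all_order all_algebra.
From mathcomp Require Import reals complex.

Set Implicit Arguments.
Unset Strict Implicit.
Unset Printing Implicit Defensive.

Import GRing.Theory.
Local Open Scope ring_scope.

(** Both sides of the equivalence speak of the same three brackets.  Compatibility
    of [(gammat, A, gamma)] with [g_0 x V -> V] is condition 1, and compatibility
    with [g_0 x V^* -> V^*] is condition 2; compatibility with [g_0 x g_0] is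
    the assumption on [A], and anticommutativity gives the brackets taken in the
    opposite order.  What remains is the bracket [V x V^* -> g_0], that is
    [A [X, Y] = [gamma X, gammat Y]].

    The bracket [V x V^* -> g_0] is defined by duality, so its image is tested
    against the elements [A U], which exhaust [g_0^2].  Condition 2 alone, read at
    the vector [gamma X], moves the action of [A U] through [gammat] and gives
    [B_2([gamma X, gammat Y], A U) = B_1([(transpose of gammat) (gamma X), Y], U)]
    (lemma [qform_pairing_transpose]).  Hence, once condition 2 holds, condition 3
    says that [A [X, Y]] and [[gamma X, gammat Y]] have the same [B_2]-product with
    every [A U], and non-degeneracy of [B_2] makes this an equality.

    Finally a morphism which is bijective in each degree is an isomorphism
    ([local_isomorphism_of_bijective]), so only compatibility with the
    brackets matters. *)

Lemma bijective_lfunK (K : fieldType) (V W : vectType K) (f : 'Hom(V, W)) :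
  bijective f -> cancel f f^-1%VF /\ cancel f^-1%VF f.
Proof.
move=> fbij.
have fK : cancel f f^-1%VF.
  by apply: lker0_lfunK; apply/lker0P; exact: bij_inj.
by split=> //; apply/(bij_can_sym fbij).
Qed.

Lemma local_isomorphism_of_bijective (K : fieldType) (G H : localLieAlg K)
    (Psi : gradedHom G H) :
  is_local_morphism Psi -> (forall i, bijective (Psi i)) ->
  is_local_isomorphism Psi.
Proof.
move=> Psi_br Psi_bij; split=> //.
exists (fun i => (Psi i)^-1%VF); split; last first.
  by move=> i; exact: bijective_lfunK.
move=> i j k e x y; apply: (bij_inj (Psi_bij k)).
have PsiK l : cancel (Psi l)^-1%VF (Psi l).
  by case: (bijective_lfunK (Psi_bij l)).
by rewrite Psi_br !PsiK.
Qed.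

Section GradedTripletMorphism.
Variables (K : fieldType) (g1 g2 : lieAlgType K).
Variables (B1 : quadForm g1) (B2 : quadForm g2) (V1 V2 : vectType K).
Variables (rho1 : lieRep g1 V1) (rho2 : lieRep g2 V2).
Variables (gammat : 'Hom(dual V1, dual V2)) (A : 'Hom(g1, g2)).
Variable gamma : 'Hom(V1, V2).

(** Among the seven brackets of a triplet, four determine the others by
    anticommutativity. *)
Lemma graded_triplet_morphismP :
  is_local_morphism (graded_triplet B1 B2 rho1 rho2 gammat A gamma) <->
  [/\ forall U U', A (lie U U') = lie (A U) (A U'),
      forall U X, gamma (rho1 U X) = rho2 (A U) (gamma X),
      forall U Y, gammat (contragredient rho1 U Y) =
                  contragredient rho2 (A U) (gammat Y)
    & forall X Y, A (pairing B1 rho1 X Y) =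
                  pairing B2 rho2 (gamma X) (gammat Y)].
Proof.
split=> [Psi_br | [A_lie gamma_rep gammat_rep A_pairing]].
  split.
  - exact: (Psi_br deg0 deg0 deg0 erefl).
  - exact: (Psi_br deg0 deg1 deg1 erefl).
  - exact: (Psi_br deg0 degN1 degN1 erefl).
  - exact: (Psi_br deg1 degN1 deg0 erefl).
(* The hypotheses settle the brackets listed above, the degrees settle the
   undefined ones; those taken in the opposite order remain. *)
case=> [] [] [] // e x y.
- by rewrite /= linearN; congr (- _); exact: gammat_rep.
- by rewrite /= linearN; congr (- _); exact: A_pairing.
- by rewrite /= linearN; congr (- _); exact: gamma_rep.
Qed.

(** Condition 2 evaluated at a vector: the transpose carries [gammat] to the other
    side of the duality bracket, and the signs of the two contragredient
    representations cancel. *)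
Lemma qform_pairing_transpose (U : g1) (x : V2) (Y : dual V1) :
  gammat (contragredient rho1 U Y) = contragredient rho2 (A U) (gammat Y) ->
  B2 (pairing B2 rho2 x (gammat Y)) (A U) =
  B1 (pairing B1 rho1 (transpose gammat x) Y) U.
Proof.
move=> gammat_rep; rewrite !qform_pairing; apply: oppr_inj.
by rewrite -!contragredientE -gammat_rep transposeE.
Qed.

End GradedTripletMorphism.

Theorem proposition3p2p1 (R : realType)
    (g1 g2 : lieAlgType R[i]) (B1 : quadForm g1) (B2 : quadForm g2)
    (V1 V2 : vectType R[i]) (rho1 : lieRep g1 V1) (rho2 : lieRep g2 V2)
    (gammat : 'Hom(dual V1, dual V2)) (gamma : 'Hom(V1, V2)) (A : 'Hom(g1, g2)) :
  bijective gammat -> bijective gamma -> is_lie_isomorphism A ->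
  is_local_isomorphism (graded_triplet B1 B2 rho1 rho2 gammat A gamma) <->
  (forall (U1 : g1) (X1 : V1) (Y1 : dual V1),
    [/\ (rho2 (A U1) \o gamma)%VF = (gamma \o rho1 U1)%VF,
        (contragredient rho2 (A U1) \o gammat)%VF =
          (gammat \o contragredient rho1 U1)%VF
      & let br : V1 -> dual V1 -> g1 :=
          @lbr _ (localLie_of_triplet B1 rho1) _ _ _ adds_1N1 in
        B2 (A (br X1 Y1)) (A U1) = B1 (br (transpose gammat (gamma X1)) Y1) U1]).
Proof.
move=> gammat_bij gamma_bij [A_bij A_lie]; split.
  case=> /graded_triplet_morphismP[_ gamma_rep gammat_rep A_pairing] _ U X Y.
  split.
  - by apply/lfunP => x; rewrite !comp_lfunE /= gamma_rep.
  - by apply/lfunP => y; rewrite !comp_lfunE /= gammat_rep.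
  - by rewrite /= A_pairing (qform_pairing_transpose B1 B2 (rho1 := rho1)).
move=> conds; apply: local_isomorphism_of_bijective; last by case.
have gammat_rep U Y : gammat (contragredient rho1 U Y) =
                      contragredient rho2 (A U) (gammat Y).
  by have [_ /lfunP/(_ Y) + _] := conds U 0 0; rewrite !comp_lfunE.
apply/graded_triplet_morphismP; split=> // [U X | X Y].
  by have [/lfunP/(_ X) + _ _] := conds U 0 0; rewrite !comp_lfunE.
have [A' _ AK] := A_bij.
apply: (qform_inj (B := B2)) => W; rewrite -(AK W).
have [_ _ /= ->] := conds (A' W) X Y.
by rewrite (qform_pairing_transpose B1 B2 (rho1 := rho1)).
Qed.
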